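(* Let $G,H$ be graphs. 1. If $a$ is a dismantlable vertex of $G$, then $\mathcal F_{\mathscr G}(\mathrm{Hom}(G,H))\searrow^{d}\mathcal F_{\mathscr G}(\mathrm{Hom}(G-a,H))$, where, $b\ne a$ being a vertex with $N_G(a)\subset N_G(b)$, $\mathcal F_{\mathscr G}(\mathrm{Hom}(G-a,H))$ is identified with a subgraph of $\mathcal F_{\mathscr G}(\mathrm{Hom}(G,H))$ by extending each indexing function $\eta$ on $V(G)\setminus\{a\}$ to $V(G)$ by $\eta(a):=\eta(b)$. 2. If $u$ is a dismantlable vertex of $H$, then $\mathcal F_{\mathscr G}(\mathrm{Hom}(G,H))\searrow^{d}\mathcal F_{\mathscr G}(\mathrm{Hom}(G,H-u))$, where $\mathcal F_{\mathscr G}(\mathrm{Hom}(G,H-u))$ is identified with a subgraph of $\mathcal F_{\mathscr G}(\mathrm{Hom}(G,H))$ by regarding an indexing function with values in the subsets of $V(H)\setminus\{u\}$ as one with values in the subsets of $V(H)$.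
   Context: Graphs are finite, undirected, without parallel edges; loops are allowed. $N_G(x)=\{y: y\sim x\}$ is the open neighborhood. A vertex $x$ of $G$ is dismantlable if there is a vertex $a\neq x$ with $N_G(x)\subset N_G(a)$. $G-x$ is the subgraph of $G$ induced by $V(G)\setminus\{x\}$. For a subgraph $H$ of $G$, $G\searrow^{d}H$ means: $H$ is the subgraph of $G$ induced by $V(H)$ and one can write $V(G)\setminus V(H)=\{x_1,\dots,x_k\}$ ($k\ge0$, distinct) so that each $x_i$ is dismantlable in the subgraph of $G$ induced by $V(H)\cup\{x_i,\dots,x_k\}$. The cells of the polyhedral complex $\mathrm{Hom}(G,H)$ are indexed by the indexing functions, i.e. functions $\eta:V(G)\to 2^{V(H)}\setminus\{\emptyset\}$ such that $x\sim y$ in $G$ implies that every element of $\eta(x)$ is adjacent in $H$ to every element of $\eta(y)$. The face graph $\mathcal F_{\mathscr G}(\mathrm{Hom}(G,H))$ is the reflexive graph whose vertices are the indexing functions, with $\eta\sim\eta'$ iff either $\eta(x)\subset\eta'(x)$ for all $x\in V(G)$ or $\eta'(x)\subset\eta(x)$ for all $x\in V(G)$. *)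

(* Defs.v *)
From mathcomp Require Import all_boot.

Set Implicit Arguments.
Unset Strict Implicit.
Unset Printing Implicit Defensive.

Record graph := Graph {
  vert :> finType;
  adj : rel vert;
  adj_sym : symmetric adj }.

Definition nbhd (G : graph) (x : G) : {set G} := [set y | adj y x].

Definition dismantlable (G : graph) (x : G) : Prop :=
  exists a : G, a != x /\ nbhd x \subset nbhd a.

Section Induced.
Variables (G : graph) (A : {set G}).

Let iadj (x y : {x : G | x \in A}) := adj (val x) (val y).

Lemma induced_sym : symmetric iadj.
Proof. by move=> x y; apply: adj_sym. Qed.

Definition induced : graph := Graph induced_sym.

Definition dismantlable_in (x : G) : Prop :=
  exists y : induced, val y = x /\ dismantlable y.
End Induced.

Definition delete (G : graph) (x : G) : graph := induced [set~ x].
Arguments delete : clear implicits.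

Record subgraph (G : graph) := Subgraph {
  sg_vert : {set G};
  sg_adj : rel G;
  sg_sym : symmetric sg_adj;
  sg_sub : forall x y, sg_adj x y ->
    [/\ x \in sg_vert, y \in sg_vert & adj x y] }.

Definition dismantles_to (G : graph) (H : subgraph G) : Prop :=
  {in sg_vert H &, forall x y, sg_adj H x y = adj x y} /\
  exists s : seq G,
    [/\ uniq s, s =i ~: sg_vert H
      & forall s1 x s2, s = s1 ++ x :: s2 ->
          dismantlable_in (sg_vert H :|: [set y in x :: s2]) x].

(* An embedding is only required to preserve adjacency, so its image need not
   be an induced subgraph. *)
Record embedding (K G : graph) := Embedding {
  emb :> K -> G;
  emb_inj : injective emb;
  emb_hom : {homo emb : x y / adj x y} }.

Section Image.
Variables (K G : graph) (f : embedding K G).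

Let madj (u v : G) :=
  [exists x : K, exists y : K, [&& u == f x, v == f y & adj x y]].

Lemma image_sym : symmetric madj.
Proof.
suff h u v : madj u v -> madj v u by move=> u v; apply/idP/idP; apply: h.
case/existsP=> x /existsP[y /and3P[ux vy xy]].
by apply/existsP; exists y; apply/existsP; exists x; rewrite vy ux adj_sym xy.
Qed.

Lemma image_sub u v : madj u v ->
  [/\ u \in [set f x | x : K], v \in [set f x | x : K] & adj u v].
Proof.
case/existsP=> x /existsP[y /and3P[/eqP-> /eqP-> xy]].
by split; [apply: imset_f | apply: imset_f | apply: emb_hom].
Qed.

Definition image_subgraph : subgraph G := Subgraph image_sym image_sub.
End Image.

Definition indexing (G H : graph) (eta : {ffun G -> {set H}}) : bool :=
  [forall x, eta x != set0] &&
  [forall x, forall y, adj x y ==>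
     [forall u in eta x, forall v in eta y, adj u v]].

Lemma indexingP (G H : graph) (eta : {ffun G -> {set H}}) :
  reflect ((forall x, eta x != set0) /\
           (forall x y, adj x y ->
              forall u v, u \in eta x -> v \in eta y -> adj u v))
          (indexing eta).
Proof.
apply: (iffP andP) => -[h0 h]; split.
- exact/forallP.
- move=> x y xy u v ux vy.
  move/forallP/(_ x)/forallP/(_ y)/implyP/(_ xy): h.
  by move/forall_inP/(_ u ux)/forall_inP/(_ v vy).
- exact/forallP.
- apply/forallP=> x; apply/forallP=> y; apply/implyP=> xy.
  by apply/forall_inP=> u ux; apply/forall_inP=> v vy; apply: (h x y).
Qed.

Definition cell (G H : graph) : finType :=
  {eta : {ffun G -> {set H}} | indexing eta}.

Section FaceGraph.
Variables G H : graph.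

Definition cell_le (eta eta' : cell G H) : bool :=
  [forall x, val eta x \subset val eta' x].

Let fadj (eta eta' : cell G H) := cell_le eta eta' || cell_le eta' eta.

Lemma face_sym : symmetric fadj.
Proof. by move=> eta eta'; apply: orbC. Qed.

Definition face_graph : graph := Graph face_sym.
End FaceGraph.

Section Extend.
Variables (G H : graph) (a b : G).
Hypotheses (ba : b != a) (Nab : nbhd a \subset nbhd b).

Lemma mem_delete : b \in [set~ a].
Proof. by rewrite in_setC1. Qed.

Definition fold_vertex (x : G) : delete G a :=
  insubd (exist _ b mem_delete : delete G a) x.

Lemma val_fold_vertex x : val (fold_vertex x) = if x == a then b else x.
Proof. by rewrite val_insubd in_setC1; case: eqP. Qed.

Definition extend_fun (eta : cell (delete G a) H) : {ffun G -> {set H}} :=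
  [ffun x => val eta (fold_vertex x)].

Lemma fold_vertex_hom : {homo fold_vertex : x y / adj x y}.
Proof.
have Na z : adj z a -> adj z b.
  by move=> za; move/subsetP/(_ z): Nab; rewrite !inE; apply.
move=> x y; rewrite /adj /= !val_fold_vertex -!/(adj _ _).
case: (x =P a) => [->|_]; case: (y =P a) => [->|_] //.
- by move=> /Na; rewrite adj_sym => /Na.
- by rewrite adj_sym => /Na; rewrite adj_sym.
- exact: Na.
Qed.

Lemma extend_indexing eta : indexing (extend_fun eta).
Proof.
have /indexingP[h0 h] := valP eta.
apply/indexingP; split=> [x|x y xy u v]; rewrite !ffunE //.
exact/h/fold_vertex_hom.
Qed.

Definition extend (eta : face_graph (delete G a) H) : face_graph G H :=
  Sub (extend_fun eta) (extend_indexing eta).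

Lemma extend_inj : injective extend.
Proof.
move=> eta eta' /(congr1 val)/= e; apply/val_inj/ffunP=> x.
have fx : fold_vertex (val x) = x.
  apply: val_inj; rewrite val_fold_vertex.
  by have := valP x; rewrite in_setC1 => /negPf->.
by move/ffunP/(_ (val x)): e; rewrite !ffunE fx.
Qed.

Lemma extend_hom : {homo extend : eta eta' / adj eta eta'}.
Proof.
move=> eta eta' /orP[] /forallP h; apply/orP; [left|right];
  by apply/forallP=> x; rewrite !ffunE.
Qed.

Definition extend_embedding := Embedding extend_inj extend_hom.
End Extend.

Section Include.
Variables (G H : graph) (u : H).

Definition include_fun (eta : cell G (delete H u)) : {ffun G -> {set H}} :=
  [ffun x => [set val v | v in val eta x]].

Lemma include_indexing eta : indexing (include_fun eta).
Proof.
have /indexingP[h0 h] := valP eta.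
apply/indexingP; split=> [x|x y xy v w]; rewrite !ffunE.
  by rewrite imset_eq0.
by case/imsetP=> v' v'x -> /imsetP[w' w'y ->]; apply: (h x y).
Qed.

Definition include (eta : face_graph G (delete H u)) : face_graph G H :=
  Sub (include_fun eta) (include_indexing eta).

Lemma include_inj : injective include.
Proof.
move=> eta eta' /(congr1 val)/= e; apply/val_inj/ffunP=> x.
move/ffunP/(_ x): e; rewrite !ffunE; apply: imset_inj; exact: val_inj.
Qed.

Lemma include_hom : {homo include : eta eta' / adj eta eta'}.
Proof.
move=> eta eta' /orP[] /forallP h; apply/orP; [left|right];
  by apply/forallP=> x; rewrite !ffunE imsetS.
Qed.

Definition include_embedding := Embedding include_inj include_hom.
End Include.

(* Main.v *)
Require Import Defs.
From mathcomp Require Import all_boot.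

(** The face graph of Hom(G,H) is the comparability graph of a finite poset,
    the cells ordered by inclusion, and a finite poset is dismantled by a
    monotone idempotent map lying on one side of the identity.  Indeed, if [c]
    is a closure operator and [x] is maximal among the remaining elements that
    [c] moves, then [c x] dominates [x]: whatever lies below [x] lies below
    [c x], and whatever lies strictly above [x] is closed, hence lies above
    [c x].  So the elements moved by [c] can be removed from the top down
    ([dismantling_closure]); the same holds for interior operators, by
    reversing the order.

    Both parts of the theorem come from one situation: a smaller face graph
    sits in Hom(G,H) by an embedding [f] that has a monotone retraction [r],
    and the monotone idempotent [f \o r] is in general not comparable with the
    identity.  It is reached by going up and then down.  The cells [eta] and
    [f (r eta)] always have a common upper bound, their pointwise union, because
    a vertex and the vertex dominating it can be used simultaneously.  The union
    [eta |-> eta :|: f (r eta)] is a closure operator, so the face graph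
    dismantles to the cells containing their own retract; on these, [f \o r]
    is an interior operator with fixed points the image of [f]
    ([dismantles_to_retract]).

    The retraction is induced by the folding map sending the dominated vertex to
    the dominating one: a cell is restricted to the remaining vertices of G
    in part 1, and its values are pushed forward along the folding of H in
    part 2. *)

Set Implicit Arguments.
Unset Strict Implicit.
Unset Printing Implicit Defensive.

(** * Dismantlings as sequences of single removals *)

Lemma dismantlable_inP (G : graph) (A : {set G}) (x a : G) :
    x \in A -> a \in A -> a != x ->
    {in A, forall y, adj y x -> adj y a} ->
  dismantlable_in A x.
Proof.
move=> xA aA ax dom; exists (exist _ x xA); split=> //.
exists (exist _ a aA); split=> //; apply/subsetP=> y.
by rewrite !inE; apply: dom (valP y).
Qed.

(** Removing one vertex at a time makes dismantlings easy to compose; the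
    enumeration of the removed vertices is recovered in [dismantling_seq]. *)
Inductive dismantling (G : graph) : {set G} -> {set G} -> Prop :=
| Dismantling0 (A : {set G}) : dismantling A A
| DismantlingS (A B : {set G}) (x : G) : x \in A -> x \notin B -> dismantlable_in A x ->
    dismantling (A :\ x) B -> dismantling A B.

Lemma dismantling_sub (G : graph) (A B : {set G}) :
  dismantling A B -> B \subset A.
Proof.
by elim=> // {}A {}B x _ _ _ _ /subset_trans; apply; apply: subsetDl.
Qed.

Lemma dismantling_trans (G : graph) (A B C : {set G}) :
  dismantling A B -> dismantling B C -> dismantling A C.
Proof.
move=> AB; elim: AB C => // {}A {}B x xA xB dx _ IH C BC.
apply: DismantlingS xA _ dx (IH _ BC).
by apply: contra xB; apply/subsetP/dismantling_sub.
Qed.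

Lemma dismantling_seq (G : graph) (A B : {set G}) : dismantling A B ->
  exists s : seq G, [/\ uniq s, s =i A :\: B
    & forall s1 x s2, s = s1 ++ x :: s2 ->
        dismantlable_in (B :|: [set y in x :: s2]) x].
Proof.
elim=> [{}A|{}A {}B x xA xB dx /dismantling_sub BA [s [us sE ds]]].
  by exists [::]; split=> [//|y|[]//]; rewrite setDv inE.
have xsE : x :: s =i A :\: B.
  move=> y; rewrite inE sE !inE.
  by case: (y =P x) => [->|] //=; rewrite xB xA.
exists (x :: s); split=> //=; first by rewrite sE !inE eqxx andbF.
case=> [|z s1] y s2 /= [].
  move=> <- <-; suff -> : B :|: [set z in x :: s] = A by [].
  apply/setP=> z; rewrite in_setU in_set xsE inE.
  case: (boolP (z \in B)) => //= zB; apply/esym.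
  by have /setD1P[] := subsetP BA z zB.
by move=> _; apply: ds.
Qed.

(** * Dismantling comparability graphs by closure operators *)

Section Closure.
Variables (P : graph) (le : rel P).
Hypotheses (le_refl : reflexive le) (le_trans : transitive le)
  (le_anti : antisymmetric le).
Hypothesis adjE : forall x y : P, adj x y = le x y || le y x.

Lemma exists_maximal (S : {set P}) : S != set0 ->
  exists2 x, x \in S & {in S, forall y, le x y -> y = x}.
Proof.
case/set0Pn=> x0 x0S.
pose rank x := #|[set y | le y x]|.
case: (arg_maxnP rank x0S) => x xS xmax; exists x => // y yS xy.
have : rank y <= rank x by apply: xmax.
rewrite leqNgt => /negP leyx.
apply: le_anti; rewrite xy andbT; apply: contraT => nyx.
case: leyx; apply/proper_card/properP; split.
  by apply/subsetP=> z; rewrite !inE => /le_trans; apply.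
by exists y; rewrite inE.
Qed.

Variables (A : {set P}) (c : P -> P).
Hypotheses (cA : {in A, forall x, c x \in A})
  (c_mono : {in A &, {homo c : x y / le x y}})
  (c_ge : {in A, forall x, le x (c x)})
  (c_idem : {in A, forall x, c (c x) = c x}).

(** The moved elements are removed from the top down.  When [x] is maximal among
    those still present, [c x] is present too, because it is closed, and every
    remaining element above [x] is either [x] or closed, hence above [c x].
    Working inside a subset [A] allows a second such map to be applied to what
    the first one leaves. *)
Lemma dismantling_closure : dismantling A [set x in A | c x == x].
Proof.
set F := [set x in A | _].
suff gen n (B : {set P}) : #|B :\: F| = n -> F \subset B -> B \subset A ->
    dismantling B F.
  by apply: gen erefl _ _ => //; apply/subsetP=> x /setIdP[].
elim: n B => [|n IH] B.
  move/eqP; rewrite cards_eq0 setD_eq0 => BF FB _.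
  have -> : B = F by apply/eqP; rewrite eqEsubset BF.
  exact: Dismantling0.
move=> cB FB BA.
have /exists_maximal[x /setDP[xB xF] xmax] : B :\: F != set0.
  by rewrite -card_gt0 cB.
have xA := subsetP BA x xB.
have cxF : c x \in F by rewrite inE cA // c_idem ?eqxx.
apply: (DismantlingS xB xF).
  apply: (@dismantlable_inP _ _ _ (c x)) => //; first exact: (subsetP FB).
    by apply: contraNneq xF => e; rewrite -{1}e.
  move=> y yB; rewrite !adjE => /orP[yx|xy].
    by rewrite (le_trans yx) // c_ge.
  have [yF|yF] := boolP (y \in F); last first.
    by rewrite (xmax y _ xy) ?c_ge ?orbT // in_setD yF yB.
  case/setIdP: yF => yA /eqP <-.
  by rewrite (c_mono xA yA xy) orbT.
apply: IH.
- apply/eqP; rewrite -eqSS -cB [in X in _ == X](cardsD1 x) inE xB xF add1n eqSS.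
  by rewrite setDDl setUC -setDDl.
- by rewrite subsetD1 FB xF.
- exact: subset_trans (subsetDl _ _) BA.
Qed.
End Closure.

(** * Face graphs and their monotone retracts *)

Section CellOrder.
Variables G H : graph.

Lemma cell_leP (eta zeta : cell G H) :
  reflect (forall x, val eta x \subset val zeta x) (cell_le eta zeta).
Proof. exact: forallP. Qed.

Lemma cell_le_refl : reflexive (@cell_le G H).
Proof. by move=> eta; apply/cell_leP. Qed.

Lemma cell_le_trans : transitive (@cell_le G H).
Proof.
move=> zeta eta theta /cell_leP h1 /cell_leP h2.
by apply/cell_leP=> x; apply: subset_trans (h1 x) (h2 x).
Qed.

Lemma cell_le_anti : antisymmetric (@cell_le G H).
Proof.
move=> eta zeta /andP[/cell_leP h1 /cell_leP h2].
by apply/val_inj/ffunP=> x; apply/eqP; rewrite eqEsubset h1 h2.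
Qed.

Lemma cell_ext (eta zeta : cell G H) :
  (forall x, val eta x = val zeta x) -> eta = zeta.
Proof. by move=> e; apply/val_inj/ffunP. Qed.
End CellOrder.

Section Retract.
Variables (G H G' H' : graph).
Variables (f : embedding (face_graph G' H') (face_graph G H))
  (r : face_graph G H -> face_graph G' H').
Hypotheses (rK : cancel f r)
  (f_mono : {homo f : eta zeta / cell_le eta zeta})
  (r_mono : {homo r : eta zeta / cell_le eta zeta}).

(** This is what makes the union of a cell and of its retract a cell. *)
Hypothesis f_r_adj : forall (eta : face_graph G H) (x y : G), adj x y ->
  forall u v, u \in val eta x -> v \in val (f (r eta)) y -> adj u v.

Definition join_fun (eta : cell G H) : {ffun G -> {set H}} :=
  [ffun x => val eta x :|: val (f (r eta)) x].

Lemma join_indexing eta : indexing (join_fun eta).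
Proof.
have /indexingP[eta0 etaP] := valP eta.
have /indexingP[_ fretaP] := valP (f (r eta)).
apply/indexingP; split=> [x|x y xy u v]; rewrite !ffunE.
  by apply: contraNneq (eta0 x) => e; rewrite -subset0 -e subsetUl.
case/setUP=> ux /setUP[] vy.
- exact: etaP xy _ _ ux vy.
- exact: f_r_adj xy _ _ ux vy.
- by rewrite adj_sym; apply: f_r_adj vy ux; rewrite adj_sym.
- exact: fretaP xy _ _ ux vy.
Qed.

Definition join (eta : face_graph G H) : face_graph G H :=
  Sub (join_fun eta) (join_indexing eta).

Lemma val_join eta x : val (join eta) x = val eta x :|: val (f (r eta)) x.
Proof. by rewrite ffunE. Qed.

(** Adding to a cell its own retract must not change the retract,
    for [join] to be idempotent. *)
Hypothesis r_join : forall eta, r (join eta) = r eta.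

Lemma join_mono : {homo join : eta zeta / cell_le eta zeta}.
Proof.
move=> eta zeta le_ez; apply/cell_leP=> x; rewrite !val_join.
by apply: setUSS; move: x; apply/cell_leP; last apply/f_mono/r_mono.
Qed.

Lemma le_join eta : cell_le eta (join eta).
Proof. by apply/cell_leP=> x; rewrite val_join subsetUl. Qed.

Lemma retract_le_join eta : cell_le (f (r eta)) (join eta).
Proof. by apply/cell_leP=> x; rewrite val_join subsetUr. Qed.

Lemma join_idem eta : join (join eta) = join eta.
Proof.
by apply: cell_ext => x; rewrite !val_join r_join -setUA setUid.
Qed.

Lemma join_image eta' : join (f eta') = f eta'.
Proof. by apply: cell_ext => x; rewrite val_join rK setUid. Qed.

(** The cells are first enlarged by [join]; its fixed points are cells
    containing their retract, and these are then shrunk by [f \o r].  Every cell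
    in the image of [f] is fixed by both maps, so it survives the two stages. *)
Lemma dismantles_to_retract : dismantles_to (image_subgraph f).
Proof.
split=> [eta zeta|] /=.
  case/imsetP=> eta' _ -> /imsetP[zeta' _ ->].
  apply/idP/idP=> [/(@image_sub _ _ f)[]//|fa].
  apply/existsP; exists eta'; apply/existsP; exists zeta'; rewrite !eqxx /=.
  by rewrite -[eta']rK -[zeta']rK; case/orP: fa => /r_mono le_ez;
    apply/orP; [left|right].
have [|s [us sE ds]] := @dismantling_seq _ setT [set f x | x : face_graph G' H'].
  have up : dismantling setT [set eta in setT | join eta == eta].
    apply: (@dismantling_closure (face_graph G H) (@cell_le G H)) => //.
    - exact: cell_le_refl.
    - exact: cell_le_trans.
    - exact: cell_le_anti.
    - by move=> eta zeta _ _; apply: join_mono.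
    - by move=> eta _; apply: le_join.
    - by move=> eta _; apply: join_idem.
  apply: dismantling_trans up _; set A := [set eta in _ | _].
  have -> : [set f x | x : face_graph G' H']
      = [set eta in A | f (r eta) == eta].
    apply/setP=> eta; rewrite !inE; apply/imsetP/andP=> [[x _ ->]|[_ /eqP<-]].
      by rewrite rK join_image !eqxx.
    by exists (r eta).
  (* [f \o r] decreases on [A], so it is a closure operator for the reverse
     order *)
  apply: (@dismantling_closure (face_graph G H) (fun eta zeta => cell_le zeta eta)).
  - exact: cell_le_refl.
  - by move=> zeta eta theta le1 le2; apply: cell_le_trans le2 le1.
  - by move=> eta zeta; rewrite andbC => /cell_le_anti.
  - by move=> eta zeta; apply: orbC.
  - by move=> eta _; rewrite !inE join_image eqxx.
  - by move=> eta zeta _ _ /r_mono/f_mono.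
  - by move=> eta; rewrite !inE => /eqP {2}<-; apply: retract_le_join.
  - by move=> eta _; rewrite rK.
by exists s; split=> // x; rewrite sE !inE andbT.
Qed.
End Retract.

(** * Retractions induced by folding a dominated vertex *)

Section Fold.
Variables (G : graph) (a b : G) (ba : b != a).

Lemma fold_vertexK : cancel val (fold_vertex ba).
Proof.
move=> x; apply: val_inj; rewrite val_fold_vertex.
by have := valP x; rewrite in_setC1 => /negPf->.
Qed.

Lemma adj_fold_vertex (x y : G) : nbhd a \subset nbhd b ->
  adj x y -> adj x (val (fold_vertex ba y)).
Proof.
move=> /subsetP Nab; rewrite val_fold_vertex; case: eqP => // -> xa.
by have := Nab x; rewrite !inE; apply.
Qed.
End Fold.

Section Restrict.
Variables (G H : graph) (a : G).

Definition restrict_fun (eta : cell G H) : {ffun delete G a -> {set H}} :=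
  [ffun x => val eta (val x)].

Lemma restrict_indexing eta : indexing (restrict_fun eta).
Proof.
have /indexingP[eta0 etaP] := valP eta.
by apply/indexingP; split=> [x|x y xy u v]; rewrite !ffunE //; apply: etaP.
Qed.

Definition restrict (eta : face_graph G H) : face_graph (delete G a) H :=
  Sub (restrict_fun eta) (restrict_indexing eta).

Lemma val_restrict eta x : val (restrict eta) x = val eta (val x).
Proof. by rewrite ffunE. Qed.
End Restrict.

(** Extending the restriction of [eta] replaces its value at [a] by its value at
    [b], so the two stages turn [eta a] first into [eta a :|: eta b], then into
    [eta b]. *)
Lemma dismantles_to_extend (G H : graph) (a b : G) (ba : b != a)
    (Nab : nbhd a \subset nbhd b) :
  dismantles_to (image_subgraph (extend_embedding H ba Nab)).
Proof.
have val_ext (eta : cell (delete G a) H) x :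
    val (extend_embedding H ba Nab eta) x = val eta (fold_vertex ba x).
  by rewrite ffunE.
have cross (eta : face_graph G H) x y : adj x y -> forall u v,
    u \in val eta x ->
    v \in val (extend_embedding H ba Nab (restrict a eta)) y -> adj u v.
  move=> xy u v ux; rewrite val_ext val_restrict.
  have /indexingP[_ etaP] := valP eta; apply: etaP ux.
  exact: adj_fold_vertex.
apply: (dismantles_to_retract (r := @restrict G H a) _ _ _ (f_r_adj := cross)).
- by move=> eta; apply: cell_ext => x; rewrite val_restrict val_ext fold_vertexK.
- by move=> eta zeta /cell_leP le_ez; apply/cell_leP=> x; rewrite !val_ext.
- by move=> eta zeta /cell_leP le_ez; apply/cell_leP=> x; rewrite !val_restrict.
- move=> eta; apply: cell_ext => x.
  by rewrite !val_restrict val_join val_ext val_restrict fold_vertexK setUid.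
Qed.

Section Push.
Variables (G H : graph) (u w : H) (wu : w != u) (Nuw : nbhd u \subset nbhd w).

Definition push_fun (eta : cell G H) : {ffun G -> {set delete H u}} :=
  [ffun x => fold_vertex wu @: val eta x].

Lemma push_indexing eta : indexing (push_fun eta).
Proof.
have /indexingP[eta0 etaP] := valP eta.
apply/indexingP; split=> [x|x y xy v1 v2]; rewrite !ffunE ?imset_eq0 //.
case/imsetP=> v1' v1x -> /imsetP[v2' v2y ->].
by apply: fold_vertex_hom => //; apply: etaP xy _ _ v1x v2y.
Qed.

Definition push (eta : face_graph G H) : face_graph G (delete H u) :=
  Sub (push_fun eta) (push_indexing eta).

Lemma val_push eta x : val (push eta) x = fold_vertex wu @: val eta x.
Proof. by rewrite ffunE. Qed.

(** The two stages first add [w] to every value containing [u], then remove [u]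
    from every value. *)
Lemma dismantles_to_include :
  dismantles_to (image_subgraph (include_embedding G u)).
Proof.
have val_incl (eta : cell G (delete H u)) x :
    val (include_embedding G u eta) x = val @: val eta x.
  by rewrite ffunE.
have cross (eta : face_graph G H) x y : adj x y -> forall v1 v2,
    v1 \in val eta x -> v2 \in val (include_embedding G u (push eta)) y ->
    adj v1 v2.
  move=> xy v1 v2 v1x; rewrite val_incl val_push => /imsetP[_ /imsetP[v vy ->] ->].
  apply: adj_fold_vertex => //.
  by have /indexingP[_ etaP] := valP eta; apply: etaP xy _ _ v1x vy.
have foldK (S : {set delete H u}) : fold_vertex wu @: (val @: S) = S.
  rewrite -imset_comp -[RHS]imset_id; apply: eq_imset => v.
  exact: fold_vertexK.
apply: (dismantles_to_retract (r := push) _ _ _ (f_r_adj := cross)).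
- by move=> eta; apply: cell_ext => x; rewrite val_push val_incl foldK.
- move=> eta zeta /cell_leP le_ez; apply/cell_leP=> x.
  by rewrite !val_incl imsetS.
- move=> eta zeta /cell_leP le_ez; apply/cell_leP=> x.
  by rewrite !val_push imsetS.
- move=> eta; apply: cell_ext => x.
  by rewrite !val_push val_join imsetU val_incl val_push foldK setUid.
Qed.
End Push.

Theorem theorem6p1 (G H : graph) :
  (forall a : G, dismantlable a ->
     forall (b : G) (ba : b != a) (Nab : nbhd a \subset nbhd b),
       dismantles_to (image_subgraph (extend_embedding H ba Nab))) /\
  (forall u : H, dismantlable u ->
     dismantles_to (image_subgraph (include_embedding G u))).
Proof.
split=> [a _ b ba Nab|u [w [wu Nuw]]]; first exact: dismantles_to_extend.
exact: dismantles_to_include wu Nuw.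
Qed.
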